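(* Let $\mathscr{D}$ be a $\Bbbk$-linear triangulated category for a field $\Bbbk$, with a t-structure $\tau$. Let $\mathscr{D}=\langle\mathscr{B},\mathscr{C}\rangle$ be a semiorthogonal decomposition. (a) If $\tau$ is noetherian and $\mathscr{B}$ is thickly generated by a finite set of objects $B_1,\dots,B_n\in{}^{\tau}\mathscr{D}^{\heartsuit}$ in the heart of $\tau$ such that $\mathrm{Hom}(B_i,B_i)=\Bbbk$ for all $i$ and $\mathrm{Hom}(B_i,B_j)=0$ for all $i\ne j$, then $\tau$ connectively induces a t-structure $\tau_{\mathscr{C}}^{-}$ on $\mathscr{C}$, which is bounded if $\tau$ is bounded. (b) If $\tau$ is artinian and $\mathscr{C}$ is thickly generated by a finite set of objects $C_1,\dots,C_n\in{}^{\tau}\mathscr{D}^{\heartsuit}$ in the heart of $\tau$ such that $\mathrm{Hom}(C_i,C_i)=\Bbbk$ for all $i$ and $\mathrm{Hom}(C_i,C_j)=0$ for all $i\ne j$, then $\tau$ coconnectively induces a t-structure $\tau_{\mathscr{B}}^{+}$ on $\mathscr{B}$, which is bounded if $\tau$ is bounded.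
   Context: Convention: in a semiorthogonal decomposition $\mathscr{D}=\langle \mathscr{B},\mathscr{C}\rangle$ one has $\mathrm{Hom}(C,B[n])=0$ for all $C\in\mathscr{C}$, $B\in\mathscr{B}$, $n\in\mathbf{Z}$, and every $D\in\mathscr{D}$ fits in a distinguished triangle $C\to D\to B$ with $C\in\mathscr{C}$, $B\in\mathscr{B}$. A subcategory is thickly generated by a set of objects if it is the smallest full triangulated subcategory closed under direct summands containing them. A t-structure $\tau=({}^{\tau}\mathscr{D}^{\le 0},{}^{\tau}\mathscr{D}^{\ge 0})$ has heart ${}^{\tau}\mathscr{D}^{\heartsuit}={}^{\tau}\mathscr{D}^{\le 0}\cap{}^{\tau}\mathscr{D}^{\ge 0}$. It is noetherian (artinian) if its heart is a noetherian (artinian) abelian category, i.e. ascending (descending) chains of subobjects of any object stabilize. It is bounded if each object lies in ${}^{\tau}\mathscr{D}^{\ge 0}[-a]\cap{}^{\tau}\mathscr{D}^{\le 0}[-b]$ for some $a,b\in\mathbf{Z}$. For a full triangulated subcategory $\mathscr{A}\subset\mathscr{D}$: - $\tau$ connectively induces a t-structure on $\mathscr{A}$ if $\tau_{\mathscr{A}}^{-}=(\mathscr{A}^{\le 0},\mathscr{A}^{\ge 0})$ with $\mathscr{A}^{\le 0}={}^{\tau}\mathscr{D}^{\le 0}\cap\mathscr{A}$ and $\mathscr{A}^{\ge 0}=\{A\in\mathscr{A}:\mathrm{Hom}(A'[1],A)=0\ \forall A'\in\mathscr{A}^{\le 0}\}$ is a t-structure on $\mathscr{A}$. - $\tau$ coconnectively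 induces a t-structure on $\mathscr{A}$ if $\tau_{\mathscr{A}}^{+}=(\mathscr{A}^{\le 0},\mathscr{A}^{\ge 0})$ with $\mathscr{A}^{\ge 0}={}^{\tau}\mathscr{D}^{\ge 0}\cap\mathscr{A}$ and $\mathscr{A}^{\le 0}=\{A\in\mathscr{A}:\mathrm{Hom}(A,A'[-1])=0\ \forall A'\in\mathscr{A}^{\ge 0}\}$ is a t-structure on $\mathscr{A}$. *)

(* Defs.v *)
From mathcomp Require Import all_boot all_algebra.

Set Implicit Arguments.
Unset Strict Implicit.
Unset Printing Implicit Defensive.

Import GRing.Theory.
Local Open Scope ring_scope.

Record klincat (k : fieldType) := KLinCat {
  ob :> Type;
  hom : ob -> ob -> lmodType k;
  idm : forall X : ob, hom X X;
  comp : forall {X Y Z : ob}, hom Y Z -> hom X Y -> hom X Z;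
  compA : forall (W X Y Z : ob) (h : hom Y Z) (g : hom X Y) (f : hom W X),
    comp h (comp g f) = comp (comp h g) f;
  comp1m : forall (X Y : ob) (f : hom X Y), comp (idm Y) f = f;
  compm1 : forall (X Y : ob) (f : hom X Y), comp f (idm X) = f;
  comp_linear_r : forall (X Y Z : ob) (g : hom Y Z) (a : k) (f f' : hom X Y),
    comp g (a *: f + f') = a *: comp g f + comp g f';
  comp_linear_l : forall (X Y Z : ob) (f : hom X Y) (a : k) (g g' : hom Y Z),
    comp (a *: g + g') f = a *: comp g f + comp g' f;
  has_zero : exists Z : ob, idm Z = 0;
  has_biprod : forall X Y : ob, exists (S : ob)
    (i1 : hom X S) (i2 : hom Y S) (p1 : hom S X) (p2 : hom S Y),
    [/\ comp p1 i1 = idm X, comp p2 i2 = idm Y, comp p2 i1 = 0,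
        comp p1 i2 = 0 & comp i1 p1 + comp i2 p2 = idm S]
}.

Arguments hom {k c} X Y : rename.
Arguments idm {k c} X : rename.
Arguments comp {k c X Y Z} g f : rename.

Notation "g \c f" := (comp g f) (at level 40, left associativity).

Section CategoryNotions.
Variables (k : fieldType) (D : klincat k).
Implicit Types (X Y Z S : D) (P : D -> Prop).

Definition is_iso X Y (f : hom X Y) : Prop :=
  exists g : hom Y X, g \c f = idm X /\ f \c g = idm Y.

Definition isomorphic X Y : Prop := exists f : hom X Y, is_iso f.

Definition is_zero X : Prop := idm X = 0.

Definition hom_vanishes X Y : Prop := forall f : hom X Y, f = 0.

Definition is_biprod X Y S : Prop :=
  exists (i1 : hom X S) (i2 : hom Y S) (p1 : hom S X) (p2 : hom S Y),
    [/\ p1 \c i1 = idm X, p2 \c i2 = idm Y, p2 \c i1 = 0,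
        p1 \c i2 = 0 & i1 \c p1 + i2 \c p2 = idm S].

Definition direct_summand X S : Prop := exists Y, is_biprod X Y S.

Definition replete P : Prop := forall X Y, isomorphic X Y -> P X -> P Y.

(* Below, P stands for the full subcategory of D on the objects satisfying P;
   monomorphisms and subobjects are those of this subcategory, not of D. *)

Definition mono_in P X Y (f : hom X Y) : Prop :=
  forall Z, P Z -> forall g h : hom Z X, f \c g = f \c h -> g = h.

Record subobject P (E : D) := Subobject {
  sub_ob : D;
  sub_mem : P sub_ob;
  sub_mor : hom sub_ob E;
  sub_mono : mono_in P sub_mor
}.

Definition sub_le P E (U V : subobject P E) : Prop :=
  exists h : hom (sub_ob U) (sub_ob V), sub_mor V \c h = sub_mor U.

Definition sub_eq P E (U V : subobject P E) : Prop := sub_le U V /\ sub_le V U.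

Definition stabilizes P E (U : nat -> subobject P E) : Prop :=
  exists N : nat, forall n : nat, (N <= n)%N -> sub_eq (U n) (U N).

Definition noetherian_cat P : Prop :=
  forall E, P E -> forall U : nat -> subobject P E,
    (forall n, sub_le (U n) (U n.+1)) -> stabilizes U.

Definition artinian_cat P : Prop :=
  forall E, P E -> forall U : nat -> subobject P E,
    (forall n, sub_le (U n.+1) (U n)) -> stabilizes U.

End CategoryNotions.

Record klinfunctor (k : fieldType) (C D : klincat k) := KLinFunctor {
  fob :> C -> D;
  fmor : forall {X Y : C}, hom X Y -> hom (fob X) (fob Y);
  fmor_id : forall X : C, fmor (idm X) = idm (fob X);
  fmor_comp : forall (X Y Z : C) (g : hom Y Z) (f : hom X Y),
    fmor (g \c f) = fmor g \c fmor f;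
  fmor_linear : forall (X Y : C) (a : k) (f g : hom X Y),
    fmor (a *: f + g) = a *: fmor f + fmor g
}.

Arguments fmor {k C D} F {X Y} f : rename.

(* The shift sh = [1] is an autoequivalence, not necessarily an automorphism;
   its quasi-inverse unsh = [-1] is part of the data. *)
Record tricat (k : fieldType) := TriCat {
  tri_cat :> klincat k;
  sh : klinfunctor tri_cat tri_cat;
  unsh : klinfunctor tri_cat tri_cat;
  sh_unit : forall X : tri_cat, hom X (unsh (sh X));
  sh_unit_iso : forall X, is_iso (sh_unit X);
  sh_unit_nat : forall (X Y : tri_cat) (f : hom X Y),
    sh_unit Y \c f = fmor unsh (fmor sh f) \c sh_unit X;
  sh_counit : forall X : tri_cat, hom (sh (unsh X)) X;
  sh_counit_iso : forall X, is_iso (sh_counit X);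
  sh_counit_nat : forall (X Y : tri_cat) (f : hom X Y),
    sh_counit Y \c fmor sh (fmor unsh f) = f \c sh_counit X;

  dist : forall {X Y Z : tri_cat}, hom X Y -> hom Y Z -> hom Z (sh X) -> Prop;
  dist_iso : forall (X Y Z X' Y' Z' : tri_cat)
    (f : hom X Y) (g : hom Y Z) (h : hom Z (sh X))
    (f' : hom X' Y') (g' : hom Y' Z') (h' : hom Z' (sh X'))
    (a : hom X X') (b : hom Y Y') (c : hom Z Z'),
    is_iso a -> is_iso b -> is_iso c ->
    b \c f = f' \c a -> c \c g = g' \c b -> fmor sh a \c h = h' \c c ->
    dist f g h -> dist f' g' h';
  dist_id : forall X Z : tri_cat, is_zero Z ->
    dist (idm X) (0 : hom X Z) (0 : hom Z (sh X));
  dist_cone : forall (X Y : tri_cat) (f : hom X Y),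
    exists (Z : tri_cat) (g : hom Y Z) (h : hom Z (sh X)), dist f g h;
  dist_rotate : forall (X Y Z : tri_cat)
    (f : hom X Y) (g : hom Y Z) (h : hom Z (sh X)),
    dist f g h <-> dist g h (- fmor sh f);
  dist_morph : forall (X Y Z X' Y' Z' : tri_cat)
    (f : hom X Y) (g : hom Y Z) (h : hom Z (sh X))
    (f' : hom X' Y') (g' : hom Y' Z') (h' : hom Z' (sh X'))
    (a : hom X X') (b : hom Y Y'),
    dist f g h -> dist f' g' h' -> b \c f = f' \c a ->
    exists c : hom Z Z', c \c g = g' \c b /\ fmor sh a \c h = h' \c c;
  dist_octahedron : forall (X Y Z X' Y' Z' : tri_cat)
    (f : hom X Y) (g : hom Y Z)
    (u : hom Y Z') (u' : hom Z' (sh X))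
    (v : hom Z X') (v' : hom X' (sh Y))
    (w : hom Z Y') (w' : hom Y' (sh X)),
    dist f u u' -> dist g v v' -> dist (g \c f) w w' ->
    exists (a : hom Z' Y') (b : hom Y' X'),
      [/\ dist a b (fmor sh u \c v'),
          a \c u = w \c g, w' \c a = u', b \c w = v
        & v' \c b = fmor sh f \c w']
}.

Arguments sh {k t} : rename.
Arguments unsh {k t} : rename.
Arguments dist {k t X Y Z} f g h : rename.

Section TriangulatedNotions.
Variables (k : fieldType) (D : tricat k).
Implicit Types (X Y Z : D) (A B C P : D -> Prop).

Definition shift X (n : int) : D :=
  match n with
  | Posz m => iter m (fob sh) X
  | Negz m => iter m.+1 (fob unsh) X
  end.

Definition triangle X Y Z : Prop :=
  exists (f : hom X Y) (g : hom Y Z) (h : hom Z (sh X)), dist f g h.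

(* P[n] as a strictly full subcategory, i.e. up to isomorphism. *)
Definition shift_sub P (n : int) : D -> Prop :=
  fun X => exists2 Y, P Y & isomorphic X (shift Y n).

(* Strictly full triangulated subcategories. *)
Definition triangulated_sub A : Prop :=
  [/\ replete A,
      forall X, is_zero X -> A X,
      forall X, A X -> A (shift X 1),
      forall X, A X -> A (shift X (-1))
    & forall X Y Z, triangle X Y Z -> A X -> A Y -> A Z].

Definition thick_sub A : Prop :=
  triangulated_sub A /\ (forall X Y, direct_summand X Y -> A Y -> A X).

Definition thickly_generated (I : Type) (G : I -> D) A : Prop :=
  [/\ thick_sub A, forall i, A (G i)
    & forall A', thick_sub A' -> (forall i, A' (G i)) ->
        forall X, A X -> A' X].

(* D = <B, C> with the convention Hom(C, B[n]) = 0. *)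
Definition semiorthogonal_decomposition B C : Prop :=
  [/\ triangulated_sub B, triangulated_sub C,
      forall X Y (n : int), C X -> B Y -> hom_vanishes X (shift Y n)
    & forall X, exists Y Z, [/\ C Y, B Z & triangle Y X Z]].

Record tpair := TPair { tle : D -> Prop; tge : D -> Prop }.

Implicit Types t tau : tpair.

(* t is a t-structure on the full triangulated subcategory A of D; here
   D^{>=1} = D^{>=0}[-1]. *)
Definition is_tstructure_on A t : Prop :=
  [/\ (forall X, tle t X -> A X) /\ (forall X, tge t X -> A X),
      replete (tle t) /\ replete (tge t),
      (forall X, shift_sub (tle t) 1 X -> tle t X) /\
        (forall X, shift_sub (tge t) (-1) X -> tge t X),
      forall X Y, tle t X -> shift_sub (tge t) (-1) Y -> hom_vanishes X Y
    & forall X, A X ->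
        exists Y Z, [/\ tle t Y, shift_sub (tge t) (-1) Z & triangle Y X Z]].

Definition is_tstructure t : Prop := is_tstructure_on (fun _ => True) t.

Definition heart t : D -> Prop := fun X => tle t X /\ tge t X.

Definition noetherian t : Prop := noetherian_cat (heart t).

Definition artinian t : Prop := artinian_cat (heart t).

Definition bounded_on A t : Prop :=
  forall X, A X -> exists a b : int,
    shift_sub (tge t) (- a) X /\ shift_sub (tle t) (- b) X.

Definition bounded t : Prop := bounded_on (fun _ => True) t.

Definition conn_pair tau A : tpair :=
  let le X := tle tau X /\ A X in
  TPair le
    (fun X => A X /\ forall X', le X' -> hom_vanishes (shift X' 1) X).

Definition coconn_pair tau A : tpair :=
  let ge X := tge tau X /\ A X in
  TPair (fun X => A X /\ forall X', ge X' -> hom_vanishes X (shift X' (-1)))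
    ge.

Definition connectively_induces tau A : Prop :=
  is_tstructure_on A (conn_pair tau A).

Definition coconnectively_induces tau A : Prop :=
  is_tstructure_on A (coconn_pair tau A).

(* "Hom(G i, G i) = k" refers to the canonical map a |-> a * id. *)
Definition hom_orthonormal (I : Type) (G : I -> D) : Prop :=
  (forall i, bijective (fun a : k => a *: idm (G i))) /\
  (forall i j, i <> j -> hom_vanishes (G i) (G j)).

End TriangulatedNotions.

(* Main.v *)
From mathcomp Require Import all_boot all_algebra.
From Stdlib Require Import Classical ClassicalEpsilon.
Require Import Defs.

(** Write D^{<=0}, D^{>=0} for the t-structure tau and consider part (a); part
    (b) is its mirror image.

    The coaisle of tau_C^- being defined by orthogonality, only truncation
    triangles have to be found: for X in C, a triangle Y -> X -> Z with Y in
    C and in D^{<=0}, and Hom(W, Z) = 0 for all W in C and D^{<=0}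
    ([connectively_inducesP]). Call an object of D^{<=0} torsion when it has no
    morphism to any B_i; such W are torsion. The triangle is found in three
    steps, each of which splits off an object Z' with Hom(W, Z') = 0.

    - Replace X by its truncation X_0 in D^{<=0}.
    - The torsion objects of the heart are closed under extensions and
      quotients, so, the heart being noetherian, the top cohomology E of X_0
      has a largest torsion subobject, and the quotient F receives no nonzero
      morphism from a torsion object ([torsion_pair_noetherian]). Replace X_0 by
      the fiber X' of X_0 -> E -> F, which is torsion
      ([torsion_coreflection]).
    - Let Y -> X' -> b be the triangle of the semiorthogonal decomposition.
      Since X' is torsion and Y is left orthogonal to B, there is no nonzero
      morphism from b to any B_i[n] with n <= 0. Such an object b of B lies in
      D^{<=-1} ([simple_minded_lt]), so Y lies in D^{<=0}.

    The last assertion is where the B_i have to be simple-minded. Every object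
    of the triangulated category generated by the B_i is an iterated extension
    of shifts B_i[n]. Two adjacent pieces in the wrong order, B_i[n] with
    n <= 0 as a subobject and B_j[m] with m > 0 as a quotient, are glued by a
    morphism B_j[m] -> B_i[n+1], which is zero or an isomorphism: the pieces can
    be exchanged, or they cancel. So all pieces with positive shift, which lie
    in D^{<=-1}, can be moved to the sub side; the other ones lie in D^{>=0}.
    An object of the thick closure is a retract of such an extension
    ([thickly_generated_sorted]), and if it has no morphism to the pieces
    of the second kind, it is a retract of an object of D^{<=-1}.

    Boundedness holds with the bounds of tau, because the intersection of C with
    D^{>=0} is contained in the coaisle of tau_C^- ([bounded_conn]). *)

Set Implicit Arguments.
Unset Strict Implicit.
Unset Printing Implicit Defensive.

Import GRing.Theory.
Local Open Scope ring_scope.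

(** * Linear categories *)

Section LinearCategory.
Variables (k : fieldType) (D : klincat k).
Implicit Types X Y Z W : D.

Lemma compDr X Y Z (g : hom Y Z) (f f' : hom X Y) :
  g \c (f + f') = g \c f + g \c f'.
Proof. by rewrite -[f]scale1r comp_linear_r !scale1r. Qed.

Lemma compDl X Y Z (f : hom X Y) (g g' : hom Y Z) :
  (g + g') \c f = g \c f + g' \c f.
Proof. by rewrite -[g]scale1r comp_linear_l !scale1r. Qed.

Lemma comp0r X Y Z (g : hom Y Z) : g \c (0 : hom X Y) = 0.
Proof. by apply: (addrI (g \c 0)); rewrite -compDr !addr0. Qed.

Lemma comp0l X Y Z (f : hom X Y) : (0 : hom Y Z) \c f = 0.
Proof. by apply: (addrI (0 \c f)); rewrite -compDl !addr0. Qed.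

Lemma compNr X Y Z (g : hom Y Z) (f : hom X Y) : g \c (- f) = - (g \c f).
Proof. by apply: (addrI (g \c f)); rewrite -compDr !subrr comp0r. Qed.

Lemma compNl X Y Z (g : hom Y Z) (f : hom X Y) : (- g) \c f = - (g \c f).
Proof. by apply: (addrI (g \c f)); rewrite -compDl !subrr comp0l. Qed.

Lemma compBr X Y Z (g : hom Y Z) (f f' : hom X Y) :
  g \c (f - f') = g \c f - g \c f'.
Proof. by rewrite compDr compNr. Qed.

Lemma compBl X Y Z (f : hom X Y) (g g' : hom Y Z) :
  (g - g') \c f = g \c f - g' \c f.
Proof. by rewrite compDl compNl. Qed.

Lemma is_zero_source X Y : is_zero X -> hom_vanishes X Y.
Proof. by move=> X0 f; rewrite -(compm1 f) X0 comp0r. Qed.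

Lemma is_zero_target X Y : is_zero Y -> hom_vanishes X Y.
Proof. by move=> Y0 f; rewrite -(comp1m f) Y0 comp0l. Qed.

Lemma isomorphic_refl X : isomorphic X X.
Proof. by exists (idm X), (idm X); rewrite comp1m. Qed.

Lemma isomorphic_sym X Y : isomorphic X Y -> isomorphic Y X.
Proof. by move=> [f [g [gf fg]]]; exists g, f. Qed.

Lemma isomorphic_trans Y X Z :
  isomorphic X Y -> isomorphic Y Z -> isomorphic X Z.
Proof.
move=> [f [f' [f'f ff']]] [g [g' [g'g gg']]].
exists (g \c f), (f' \c g'); split.
  by rewrite -compA (compA g') g'g comp1m.
by rewrite -compA (compA f) ff' comp1m.
Qed.

Lemma is_zero_iso X Y : isomorphic X Y -> is_zero X -> is_zero Y.
Proof.
by move=> [f [g [_ fg]]] X0; rewrite /is_zero -fg (is_zero_source X0 f) comp0l.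
Qed.

Lemma hom_vanishes_iso X X' Y Y' : isomorphic X X' -> isomorphic Y Y' ->
  hom_vanishes X Y -> hom_vanishes X' Y'.
Proof.
move=> [f [f' [_ ff']]] [g [g' [_ gg']]] XY p.
have -> : p = g \c (g' \c p \c f) \c f'.
  by rewrite -!compA ff' compm1 compA gg' comp1m.
by rewrite (XY (g' \c p \c f)) comp0r comp0l.
Qed.

Lemma hom_vanishes_isol X X' Y :
  isomorphic X X' -> hom_vanishes X Y -> hom_vanishes X' Y.
Proof. by move=> XX'; apply: hom_vanishes_iso XX' (isomorphic_refl Y). Qed.

Lemma hom_vanishes_isor X Y Y' :
  isomorphic Y Y' -> hom_vanishes X Y -> hom_vanishes X Y'.
Proof. exact: hom_vanishes_iso (isomorphic_refl X). Qed.

Definition retract X W : Prop :=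
  exists (i : hom X W) (p : hom W X), p \c i = idm X.

End LinearCategory.

Section LinearFunctor.
Variables (k : fieldType) (C D : klincat k) (F : klinfunctor C D).
Implicit Types X Y : C.

Lemma fmorD X Y (f g : hom X Y) : fmor F (f + g) = fmor F f + fmor F g.
Proof. by rewrite -[f]scale1r fmor_linear !scale1r. Qed.

Lemma fmor0 X Y : fmor F (0 : hom X Y) = 0.
Proof. by apply: (addrI (fmor F 0)); rewrite -fmorD !addr0. Qed.

Lemma fmorN X Y (f : hom X Y) : fmor F (- f) = - fmor F f.
Proof. by apply: (addrI (fmor F f)); rewrite -fmorD !subrr fmor0. Qed.

Lemma is_iso_fmor X Y (f : hom X Y) : is_iso f -> is_iso (fmor F f).
Proof.
by move=> [g [gf fg]]; exists (fmor F g); rewrite -!fmor_comp gf fg !fmor_id.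
Qed.

Lemma isomorphic_fob X Y : isomorphic X Y -> isomorphic (F X) (F Y).
Proof. by move=> [f fiso]; exists (fmor F f); apply: is_iso_fmor. Qed.

Lemma is_zero_fob X : is_zero X -> is_zero (F X).
Proof. by rewrite /is_zero -fmor_id => ->; rewrite fmor0. Qed.

Lemma retract_fob X W : retract X W -> retract (F X) (F W).
Proof.
move=> [i [p pi]]; exists (fmor F i), (fmor F p).
by rewrite -fmor_comp pi fmor_id.
Qed.

End LinearFunctor.

(** * Triangulated categories *)

Section Triangulated.
Variables (k : fieldType) (D : tricat k).
Implicit Types X Y Z W V : D.

Lemma sh_unshK X : isomorphic (sh (unsh X)) X.
Proof. by exists (sh_counit X); apply: sh_counit_iso. Qed.

Lemma unsh_shK X : isomorphic (unsh (sh X)) X.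
Proof.
by apply: isomorphic_sym; exists (sh_unit X); apply: sh_unit_iso.
Qed.

Lemma sh_faithful X Y (f : hom X Y) : fmor sh f = 0 -> f = 0.
Proof.
move=> f0; have [e [ee _]] := sh_unit_iso Y.
by rewrite -(comp1m f) -ee -compA sh_unit_nat f0 fmor0 comp0l comp0r.
Qed.

Lemma unsh_faithful X Y (f : hom X Y) : fmor unsh f = 0 -> f = 0.
Proof.
move=> f0; have [e [_ ee]] := sh_counit_iso X.
by rewrite -(compm1 f) -ee compA -sh_counit_nat f0 fmor0 comp0r comp0l.
Qed.

Lemma sh_full X Y (f : hom (sh X) (sh Y)) : exists g : hom X Y, fmor sh g = f.
Proof.
have [e [ee ee']] := sh_unit_iso Y.
exists (e \c fmor unsh f \c sh_unit X).
apply/eqP; rewrite -subr_eq0; apply/eqP; apply: unsh_faithful.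
rewrite fmorD fmorN; apply/eqP; rewrite subr_eq0; apply/eqP.
have [d [_ dd]] := sh_unit_iso X.
rewrite -[LHS]compm1 -dd compA -sh_unit_nat -!compA dd compm1.
by rewrite compA ee' comp1m.
Qed.

Lemma hom_vanishes_sh X Y :
  hom_vanishes (sh X) (sh Y) <-> hom_vanishes X Y.
Proof.
split=> XY f; first by apply: sh_faithful; apply: XY.
by have [g <-] := sh_full f; rewrite (XY g) fmor0.
Qed.

Lemma hom_vanishes_sh_unsh X Y :
  hom_vanishes (sh X) Y <-> hom_vanishes X (unsh Y).
Proof.
split=> XY.
  by apply/hom_vanishes_sh/(hom_vanishes_isor _ XY)/isomorphic_sym/sh_unshK.
by move/hom_vanishes_sh: XY; apply/hom_vanishes_isor/sh_unshK.
Qed.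

Lemma hom_vanishes_unsh_sh X Y :
  hom_vanishes (unsh X) Y <-> hom_vanishes X (sh Y).
Proof.
split=> XY.
  by move/hom_vanishes_sh: XY; apply/hom_vanishes_isol/sh_unshK.
by apply/hom_vanishes_sh/(hom_vanishes_isol _ XY)/isomorphic_sym/sh_unshK.
Qed.

(** ** Long exact sequences *)

Lemma exists_zero : exists O : D, is_zero O.
Proof. exact: has_zero. Qed.

Lemma dist_comp0 X Y Z (f : hom X Y) (g : hom Y Z) (h : hom Z (sh X)) :
  dist f g h -> g \c f = 0.
Proof.
move=> T; have [O O0] := exists_zero.
have [] := dist_morph (a := idm X) (b := f) (dist_id X O0) T.
  by [].
by move=> c [<- _]; rewrite comp0r.
Qed.

(** Exactness of Hom(W, -): compare the rotation of the triangle with the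
    triangle W -> 0 -> W[1]. *)
Lemma dist_lift X Y Z W (f : hom X Y) (g : hom Y Z) (h : hom Z (sh X))
    (p : hom W Y) :
  dist f g h -> g \c p = 0 -> exists q : hom W X, f \c q = p.
Proof.
move=> T gp; have [O O0] := exists_zero.
have T0 := iffLR (dist_rotate _ _ _) (dist_id W O0).
have [|c [_]] := dist_morph (a := p) (b := 0 : hom O Z) T0
  (iffLR (dist_rotate _ _ _) T).
  by rewrite comp0l gp.
rewrite fmor_id compNr compNl compm1 => /oppr_inj; have [q <-] := sh_full c.
move=> E; exists q; apply/eqP; rewrite -subr_eq0; apply/eqP/sh_faithful.
by rewrite fmorD fmorN fmor_comp E subrr.
Qed.

Lemma dist_extend X Y Z W (f : hom X Y) (g : hom Y Z) (h : hom Z (sh X))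
    (p : hom Y W) :
  dist f g h -> p \c f = 0 -> exists q : hom Z W, q \c g = p.
Proof.
move=> T pf; have [O O0] := exists_zero.
have T0 : dist (0 : hom O W) (idm W) 0.
  by apply/dist_rotate; rewrite fmor0 oppr0; apply/dist_id/is_zero_fob.
have [|c [cg _]] := dist_morph (a := 0 : hom X O) (b := p) T T0.
  by rewrite comp0l.
by exists c; rewrite cg comp1m.
Qed.

(** A morphism killed by f factors, after a shift, through the third object. *)
Lemma dist_mono X Y Z W (f : hom X Y) (g : hom Y Z) (h : hom Z (sh X))
    (p : hom W X) :
  dist f g h -> hom_vanishes (sh W) Z -> f \c p = 0 -> p = 0.
Proof.
move=> /dist_rotate/dist_rotate T WZ fp.
have [|q hq] := dist_lift (p := fmor sh p) T.
  by rewrite compNl -fmor_comp fp fmor0 oppr0.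
by apply: sh_faithful; rewrite -hq (WZ q) comp0r.
Qed.

Lemma dist_epi X Y Z W (f : hom X Y) (g : hom Y Z) (h : hom Z (sh X))
    (p : hom Z W) :
  dist f g h -> hom_vanishes (sh X) W -> p \c g = 0 -> p = 0.
Proof.
move=> /dist_rotate T XW pg.
by have [q <-] := dist_extend T pg; rewrite (XW q) comp0l.
Qed.

Lemma hom_vanishes_extr X Y Z W : triangle X Y Z ->
  hom_vanishes W X -> hom_vanishes W Z -> hom_vanishes W Y.
Proof.
move=> [f [g [h T]]] WX WZ p.
by have [q <-] := dist_lift T (WZ (g \c p)); rewrite (WX q) comp0r.
Qed.

Lemma hom_vanishes_extl X Y Z W : triangle X Y Z ->
  hom_vanishes X W -> hom_vanishes Z W -> hom_vanishes Y W.
Proof.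
move=> [f [g [h T]]] XW ZW p.
by have [q <-] := dist_extend T (XW (p \c f)); rewrite (ZW q) comp0l.
Qed.

(** The five lemma, in the only case needed: c - 1 factors through h on the
    right and is killed by h on the left, so its square is zero. *)
Lemma dist_endo_iso X Y Z (f : hom X Y) (g : hom Y Z) (h : hom Z (sh X))
    (c : hom Z Z) :
  dist f g h -> c \c g = g -> h \c c = h -> is_iso c.
Proof.
move=> T cg hc; set n := c - idm Z.
have [|d dh] := dist_extend (p := n) (iffLR (dist_rotate _ _ _) T).
  by rewrite compBl cg comp1m subrr.
have hn : h \c n = 0 by rewrite compBr hc compm1 subrr.
have nn : n \c n = 0 by rewrite -{1}dh -compA hn comp0r.
have -> : c = idm Z + n by rewrite addrC subrK.
clearbody n; clear -nn.
exists (idm Z - n); split.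
  by rewrite compBl !compDr !comp1m compm1 nn addr0 addrK.
by rewrite compDl comp1m compBr compm1 nn subr0 subrK.
Qed.

(** ** Triangles up to isomorphism *)

Lemma triangle_iso X Y Z X' Y' Z' :
  isomorphic X X' -> isomorphic Y Y' -> isomorphic Z Z' ->
  triangle X Y Z -> triangle X' Y' Z'.
Proof.
move=> [a ai] [b bi] [c ci] [f [g [h T]]].
have [a' [a'a aa']] := ai; have [b' [b'b bb']] := bi.
have [c' [c'c cc']] := ci.
exists (b \c f \c a'), (c \c g \c b'), (fmor sh a \c h \c c').
apply: (dist_iso ai bi ci _ _ _ T).
- by rewrite -!compA a'a compm1.
- by rewrite -!compA b'b compm1.
- by rewrite -!compA c'c compm1.
Qed.

Lemma triangle_rot X Y Z : triangle X Y Z -> triangle Y Z (sh X).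
Proof. by move=> [f [g [h /dist_rotate T]]]; exists g, h, (- fmor sh f). Qed.

(** Rotating backwards keeps the first morphism: it becomes the second one. *)
Lemma dist_unrot X Y Z (f : hom X Y) (g : hom Y Z) (h : hom Z (sh X)) :
  dist f g h ->
  exists (u : hom (unsh Z) X) (w : hom Y (sh (unsh Z))), dist u f w.
Proof.
move=> T; have [e [ee ee']] := sh_counit_iso Z.
have [u uE] := sh_full (- (h \c sh_counit Z)).
exists u, (e \c g); apply/dist_rotate.
have id_iso W : is_iso (idm W) by exists (idm W); rewrite comp1m.
have e_iso : is_iso e by exists (sh_counit Z).
apply: (dist_iso (id_iso X) (id_iso Y) e_iso _ _ _ T).
- by rewrite comp1m compm1.
- by rewrite compm1.
- by rewrite fmor_id comp1m uE opprK -compA ee' compm1.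
Qed.

Lemma triangle_unrot X Y Z : triangle X Y Z -> triangle (unsh Z) X Y.
Proof.
by move=> [f [g [h /dist_unrot[u [w T]]]]]; exists u, f, w.
Qed.

Lemma triangle_sh X Y Z : triangle X Y Z -> triangle (sh X) (sh Y) (sh Z).
Proof. by do 3! move/triangle_rot. Qed.

Lemma triangle_unsh X Y Z :
  triangle X Y Z -> triangle (unsh X) (unsh Y) (unsh Z).
Proof. by do 3! move/triangle_unrot. Qed.

Lemma triangle_zero3 X Y Z : triangle X Y Z -> is_zero Z -> isomorphic X Y.
Proof.
move=> [f [g [h T]]] Z0; exists f.
have [s fs] := dist_lift (p := idm Y) T (is_zero_target Z0 _).
exists s; split=> //; apply/eqP; rewrite -subr_eq0; apply/eqP.
apply: (dist_mono T); first exact: is_zero_target.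
by rewrite compBr compA fs comp1m compm1 subrr.
Qed.

Lemma triangle_zero1 X Y Z : triangle X Y Z -> is_zero X -> isomorphic Y Z.
Proof.
by move=> /triangle_rot/triangle_zero3 + X0; apply; apply: is_zero_fob.
Qed.

Lemma triangle_zero2 X Y Z :
  triangle X Y Z -> is_zero Y -> isomorphic Z (sh X).
Proof. by move=> /triangle_rot/triangle_zero1. Qed.

Lemma triangle_idr X Z : is_zero Z -> triangle X X Z.
Proof. by move=> Z0; exists (idm X), 0, 0; apply: dist_id. Qed.

Lemma triangle_idl X Z : is_zero Z -> triangle Z X X.
Proof.
move=> Z0; have /triangle_unrot := triangle_idr X (is_zero_fob sh Z0).
exact: triangle_iso (unsh_shK Z) (isomorphic_refl X) (isomorphic_refl X).
Qed.

(** ** Octahedra *)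

(** The two forms of the octahedron used below compute the cone of a composite
    from the two cones, and the fiber of a composite from the two fibers. *)
Lemma cone_comp X Y Z W V (f : hom X Y) (g : hom Y Z) (h : hom Z (sh X))
    (f' : hom Y W) (g' : hom W V) (h' : hom V (sh Y)) :
  dist f g h -> dist f' g' h' ->
  exists (T : D) (t : hom W T) (w : hom T (sh X)),
    dist (f' \c f) t w /\ triangle Z T V.
Proof.
move=> T1 T2; have [T [t [w T3]]] := dist_cone (f' \c f).
have [a [b [T4 _ _ _ _]]] := dist_octahedron T1 T2 T3.
by exists T, t, w; split=> //; exists a, b, (fmor sh g \c h').
Qed.

Lemma fiber_comp X W T Z V (f : hom X W) (g : hom W T) (h : hom T (sh X))
    (f' : hom Z T) (g' : hom T V) (h' : hom V (sh Z)) :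
  dist f g h -> dist f' g' h' ->
  exists (Y : D) (y : hom Y W) (w : hom V (sh Y)),
    dist y (g' \c g) w /\ triangle X Y Z.
Proof.
move=> /dist_rotate T1 /dist_rotate T2.
have [S [t [w [/dist_unrot[u [w' T3]] /triangle_unsh]]]] := cone_comp T1 T2.
move/(triangle_iso (unsh_shK X) (isomorphic_refl _) (unsh_shK Z)) => T4.
by exists (unsh S), u, w'.
Qed.

(** Read as statements on iterated extensions, they say that X * (Z * V) and
    (X * Z) * V contain the same objects. *)
Lemma triangle_assocl X Y Z W V : triangle X Y Z -> triangle Y W V ->
  exists2 T, triangle X W T & triangle Z T V.
Proof.
move=> [f [g [h T1]]] [f' [g' [h' T2]]].
have [T [t [w [T3 T4]]]] := cone_comp T1 T2.
by exists T => //; exists (f' \c f), t, w.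
Qed.

Lemma triangle_assocr X W T Z V : triangle X W T -> triangle Z T V ->
  exists2 Y, triangle X Y Z & triangle Y W V.
Proof.
move=> [f [g [h T1]]] [f' [g' [h' T2]]].
have [Y [y [w [T3 T4]]]] := fiber_comp T1 T2.
by exists Y => //; exists y, (g' \c g), w.
Qed.

Lemma dist_iso_cone X Y Z (f : hom X Y) (g : hom Y Z) (h : hom Z (sh X)) :
  dist f g h -> is_iso f -> is_zero Z.
Proof.
move=> T [e [ef fe]].
have g0 : g = 0 by rewrite -(compm1 g) -fe compA (dist_comp0 T) comp0l.
have h0 : h = 0.
  rewrite -(comp1m h) -fmor_id -ef fmor_comp -compA.
  have /dist_comp0/eqP := iffLR (dist_rotate _ _ _) (iffLR (dist_rotate _ _ _) T).
  by rewrite compNl oppr_eq0 => /eqP->; rewrite comp0r.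
have [|q] := dist_lift (p := idm Z) (iffLR (dist_rotate _ _ _) T).
  by rewrite h0 comp0l.
by rewrite g0 comp0l.
Qed.

Lemma sh_zero X : is_zero (sh X) -> is_zero X.
Proof. by rewrite /is_zero -fmor_id; apply: sh_faithful. Qed.

Lemma sh_iso X Y : isomorphic (sh X) (sh Y) -> isomorphic X Y.
Proof.
move=> /(isomorphic_fob unsh) XY.
apply: isomorphic_trans (unsh_shK Y); apply: isomorphic_trans XY.
exact/isomorphic_sym/unsh_shK.
Qed.

(** Composing a section of g with g gives an isomorphism, whose cone is zero;
    the octahedron then identifies the cone of the section with X. *)
Lemma triangle_split X Y Z (f : hom X Y) (g : hom Y Z) :
  dist f g 0 -> triangle Z Y X.
Proof.
move=> T; have [s gs] := dist_lift (p := idm Z) (iffLR (dist_rotate _ _ _) T)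
  (comp0l _ _).
have [W [t [w T1]]] := dist_cone s.
have [S [q [r [T2 T3]]]] := cone_comp T1 (iffLR (dist_rotate _ _ _) T).
have S0 : is_zero S.
  by apply: (dist_iso_cone T2); rewrite gs; exists (idm Z); rewrite comp1m.
have XW := sh_iso (triangle_zero2 T3 S0).
apply: triangle_iso (isomorphic_refl Z) (isomorphic_refl Y) (isomorphic_sym XW) _.
by exists s, t, w.
Qed.

Lemma dist_iso_boundary X Y Z (f : hom X Y) (g : hom Y Z) (h : hom Z (sh X)) :
  dist f g h -> is_iso h -> is_zero Y.
Proof.
by do 2! move/dist_rotate; move=> T hi; apply/sh_zero/(dist_iso_cone T hi).
Qed.

End Triangulated.

(** * Extension closures and simple-minded collections *)

Section Filtrations.
Variables (k : fieldType) (D : tricat k).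
Implicit Types (X Y Z W : D) (P Q S : D -> Prop).

(** The extension closure of S. Letters are added on the sub side only; closure
    under all extensions is [filt_ext], by associativity. *)
Inductive filt S : D -> Prop :=
  | filt_zero X of is_zero X : filt S X
  | filt_cons X Y Z of S X & filt S Z & triangle X Y Z : filt S Y.

Definition star P Q Y : Prop := exists X Z, [/\ P X, Q Z & triangle X Y Z].

Lemma filt_iso S X Y : isomorphic X Y -> filt S X -> filt S Y.
Proof.
move=> XY FX; case: FX XY => {X} [X X0 XY | A X Z SA FZ T XY].
  by apply/filt_zero/(is_zero_iso XY).
apply: (filt_cons SA FZ).
exact: triangle_iso (isomorphic_refl _) XY (isomorphic_refl _) T.
Qed.

Lemma filt1 S X : S X -> filt S X.
Proof.
have [O O0] := exists_zero D => SX.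
exact: filt_cons SX (filt_zero S O0) (triangle_idr X O0).
Qed.

Lemma filt_ext S X Y Z : filt S X -> filt S Z -> triangle X Y Z -> filt S Y.
Proof.
move=> FX; elim: FX Y => {X} [X X0 | A X Z' SA _ IH T] Y FZ T'.
  by apply: filt_iso FZ; apply/isomorphic_sym/(triangle_zero1 T').
have [V T1 T2] := triangle_assocl T T'.
exact: filt_cons SA (IH _ FZ T2) T1.
Qed.

Lemma filt_ind_ext S P :
  (forall X, is_zero X -> P X) -> (forall X, S X -> P X) ->
  (forall X Y Z, P X -> P Z -> triangle X Y Z -> P Y) ->
  forall X, filt S X -> P X.
Proof.
move=> P0 PS Pext X; elim=> [{}X /P0 // | A {}X Z SA _ PZ].
by apply: Pext => //; apply: PS.
Qed.

Variables (I : finType) (G : I -> D).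

Definition pos_shift X : Prop :=
  exists i m, isomorphic X (iter m.+1 (fob sh) (G i)).

Definition nonpos_shift X : Prop :=
  exists i m, isomorphic X (iter m (fob unsh) (G i)).

(** The iterated extensions of shifts of the G i in which the strictly positive
    shifts all come on the sub side. *)
Definition sorted_filt : D -> Prop := star (filt pos_shift) (filt nonpos_shift).

Hypothesis boundary : forall L R, pos_shift L -> nonpos_shift R ->
  forall f : hom L (sh R), f = 0 \/ is_iso f.

(** A zero boundary morphism splits the extension, whose summands can then be
    exchanged; an invertible one makes both letters cancel. *)
Lemma swap_letters R Y L : nonpos_shift R -> pos_shift L -> triangle R Y L ->
  triangle L Y R \/ is_zero Y.
Proof.
move=> SR SL [f [g [h T]]]; have [h0 | hi] := boundary SL SR h.
  by left; apply: (triangle_split (f := f) (g := g)); rewrite -h0.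
by right; apply: dist_iso_boundary T hi.
Qed.

Lemma insert_letter R X Y : nonpos_shift R -> filt pos_shift X ->
  triangle R Y X -> sorted_filt Y.
Proof.
move=> SR FX T.
(* R travels through X until it reaches the end or cancels a letter. *)
suff [L [R' [FL SR' T']]] : exists L R',
    [/\ filt pos_shift L, nonpos_shift R' \/ is_zero R' & triangle L Y R'].
  by exists L, R'; split=> //; case: SR' => [/filt1 | /filt_zero]; apply.
elim: FX Y T => {X} [X X0 | L X X' SL FX' IH T1] Y T.
  have /isomorphic_sym YR := triangle_zero3 T X0.
  exists X, R; split; [exact: filt_zero | by left |].
  apply: triangle_iso (triangle_idl R X0); try exact: isomorphic_refl.
  exact: isomorphic_sym.
have [Z T2 T3] := triangle_assocr T T1.
have [T4 | Z0] := swap_letters SR SL T2.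
  have [V T5 T6] := triangle_assocl T4 T3.
  have [L' [R' [FL' SR' T7]]] := IH _ T6.
  have [U T8 T9] := triangle_assocr T5 T7.
  by exists U, R'; split=> //; apply: filt_cons T8.
have /isomorphic_sym XY := triangle_zero1 T3 Z0.
exists X', Z; split; [by [] | by right |].
exact: triangle_iso (isomorphic_refl _) XY (isomorphic_refl _) (triangle_idr X' Z0).
Qed.

Lemma sorted_filt_swap R Y L :
  filt nonpos_shift R -> filt pos_shift L -> triangle R Y L -> sorted_filt Y.
Proof.
move=> FR FL; elim: FR Y => {R} [R R0 | A R R' SA FR' IH T1] Y T.
  exists L, R; split=> //; first exact: filt_zero.
  apply: triangle_iso (isomorphic_refl _) _ (isomorphic_refl _) (triangle_idr L R0).
  exact/isomorphic_sym/(triangle_zero1 T).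
have [Z T2 T3] := triangle_assocl T1 T.
have [L1 [R1 [FL1 FR1 T4]]] := IH _ T3.
have [V T5 T6] := triangle_assocr T2 T4.
have [L2 [R2 [FL2 FR2 T7]]] := insert_letter SA FL1 T5.
have [U T8 T9] := triangle_assocl T7 T6.
by exists L2, U; split=> //; apply: filt_ext T9.
Qed.

Lemma sorted_filt_ext X Y Z :
  sorted_filt X -> sorted_filt Z -> triangle X Y Z -> sorted_filt Y.
Proof.
move=> [L1 [R1 [FL1 FR1 T1]]] [L2 [R2 [FL2 FR2 T2]]] T.
have [V T3 T4] := triangle_assocl T1 T.
have [U T5 T6] := triangle_assocr T4 T2.
have [L3 [R3 [FL3 FR3 T7]]] := sorted_filt_swap FR1 FL2 T5.
have [W T8 T9] := triangle_assocl T7 T6.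
have [M T10 T11] := triangle_assocr T3 T8.
by exists M, W; split=> //; [apply: filt_ext T10 | apply: filt_ext T9].
Qed.

Lemma sorted_filt_pos X : filt pos_shift X -> sorted_filt X.
Proof.
have [O O0] := exists_zero D => FX.
by exists X, O; split=> //; [apply: filt_zero | apply: triangle_idr].
Qed.

Lemma sorted_filt_nonpos X : filt nonpos_shift X -> sorted_filt X.
Proof.
have [O O0] := exists_zero D => FX.
by exists O, X; split=> //; [apply: filt_zero | apply: triangle_idl].
Qed.

Lemma sorted_filt_functor (F : D -> D) :
  (forall X Y Z, triangle X Y Z -> triangle (F X) (F Y) (F Z)) ->
  (forall X, is_zero X -> is_zero (F X)) ->
  (forall X, pos_shift X \/ nonpos_shift X -> sorted_filt (F X)) ->
  forall X, sorted_filt X -> sorted_filt (F X).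
Proof.
move=> FT F0 FS X [L [R [FL FR /FT T]]]; apply: sorted_filt_ext T.
- move: L FL; apply: filt_ind_ext.
  + by move=> Z Z0; apply/sorted_filt_pos/filt_zero/F0.
  + by move=> Z SZ; apply: FS; left.
  + by move=> ? ? ? h1 h2 /FT; apply: sorted_filt_ext.
- move: R FR; apply: filt_ind_ext.
  + by move=> Z Z0; apply/sorted_filt_pos/filt_zero/F0.
  + by move=> Z SZ; apply: FS; right.
  + by move=> ? ? ? h1 h2 /FT; apply: sorted_filt_ext.
Qed.

Lemma sorted_filt_sh X : sorted_filt X -> sorted_filt (sh X).
Proof.
apply: (sorted_filt_functor (F := fob sh)) => [? ? ? | ? | {}X].
- exact: triangle_sh.
- exact: is_zero_fob.
case=> [[i [m XG]] | [i [[|m] XG]]].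
- by apply/sorted_filt_pos/filt1; exists i, m.+1; apply: isomorphic_fob XG.
- by apply/sorted_filt_pos/filt1; exists i, 0%N; apply: isomorphic_fob XG.
- apply/sorted_filt_nonpos/filt1; exists i, m.
  exact: isomorphic_trans (isomorphic_fob sh XG) (sh_unshK _).
Qed.

Lemma sorted_filt_unsh X : sorted_filt X -> sorted_filt (unsh X).
Proof.
apply: (sorted_filt_functor (F := fob unsh)) => [? ? ? | ? | {}X].
- exact: triangle_unsh.
- exact: is_zero_fob.
case=> [[i [[|m] XG]] | [i [m XG]]].
- apply/sorted_filt_nonpos/filt1; exists i, 0%N.
  exact: isomorphic_trans (isomorphic_fob unsh XG) (unsh_shK _).
- apply/sorted_filt_pos/filt1; exists i, m.
  exact: isomorphic_trans (isomorphic_fob unsh XG) (unsh_shK _).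
- by apply/sorted_filt_nonpos/filt1; exists i, m.+1; apply: isomorphic_fob XG.
Qed.

(** The thick closure of a triangulated subcategory consists of its retracts:
    this avoids direct sums of triangles. *)
Definition sorted_thick X : Prop := exists2 W, sorted_filt W & retract X W.

(** A morphism between retracts extends to the ambient objects, so the cone
    of the former is a retract of the cone of the latter up to an endomorphism,
    invertible by the five lemma. *)
Lemma sorted_thick_cone X Y Z :
  triangle X Y Z -> sorted_thick X -> sorted_thick Y -> sorted_thick Z.
Proof.
move=> [f [g [h T]]] [X' FX [i [p pi]]] [Y' FY [j [q qj]]].
have [Z' [g' [h' T']]] := dist_cone (j \c f \c p).
exists Z'.
  apply: sorted_filt_ext FY (sorted_filt_sh FX) (triangle_rot _).
  by exists (j \c f \c p), g', h'.
(* The composite of the two induced morphisms d c is the identity on the first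
   two vertices, hence invertible. *)
have [|c [cg ch]] := dist_morph (a := i) (b := j) T T'.
  by rewrite -!compA pi compm1.
have [|d [dg dh]] := dist_morph (a := p) (b := q) T' T.
  by rewrite !compA qj comp1m.
have [||e [ed _]] := dist_endo_iso (c := d \c c) T.
- by rewrite -compA cg compA dg -compA qj compm1.
- by rewrite compA -dh -compA -ch compA -fmor_comp pi fmor_id comp1m.
- by exists c, (e \c d); rewrite -compA.
Qed.

Lemma thick_sub_sorted : thick_sub sorted_thick.
Proof.
split; first split.
- move=> X Y [f [g [gf fg]]] [W FW [i [p pi]]]; exists W => //.
  by exists (i \c g), (f \c p); rewrite -compA (compA p) pi comp1m.
- move=> X X0; exists X; first exact/sorted_filt_pos/filt_zero.
  by exists (idm X), (idm X); rewrite comp1m.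
- move=> X [W FW XW]; exists (sh W); first exact: sorted_filt_sh.
  exact: retract_fob.
- move=> X [W FW XW]; exists (unsh W); first exact: sorted_filt_unsh.
  exact: retract_fob.
- by move=> X Y Z T; apply: sorted_thick_cone T.
move=> X S [Y [i1 [_ [p1 [_ [pi _ _ _ _]]]]]] [W FW [i [p ip]]].
exists W => //; exists (i \c i1), (p1 \c p).
by rewrite -compA (compA p) ip comp1m.
Qed.

Lemma thickly_generated_sorted A :
  thickly_generated G A -> forall X, A X -> sorted_thick X.
Proof.
move=> [_ _ Amin]; apply: Amin thick_sub_sorted _ => i.
exists (G i); last by exists (idm _), (idm _); rewrite comp1m.
by apply/sorted_filt_nonpos/filt1; exists i, 0%N; apply: isomorphic_refl.
Qed.

End Filtrations.

(** * Maximal elements from chain conditions *)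

Lemma exists_maximal (T : Type) (R : T -> T -> Prop) (P : T -> Prop) :
  (forall U : nat -> T, (forall n, R (U n) (U n.+1)) ->
     exists N, R (U N.+1) (U N)) ->
  (exists x, P x) -> exists x, P x /\ forall y, P y -> R x y -> R y x.
Proof.
move=> chain [x0 Px0]; apply: NNPP => nomax.
have step (x : {x | P x}) : exists y : {x | P x},
    R (sval x) (sval y) /\ ~ R (sval y) (sval x).
  apply: NNPP => nostep; apply: nomax; exists (sval x); split=> [|y Py Rxy].
    exact: svalP.
  by apply: NNPP => Ryx; apply: nostep; exists (exist _ y Py).
pose next x := proj1_sig (constructive_indefinite_description _ (step x)).
have nextP x : R (sval x) (sval (next x)) /\ ~ R (sval (next x)) (sval x).
  by rewrite /next; case: constructive_indefinite_description.
have [n|N] := chain (fun n => sval (iter n next (exist _ x0 Px0))).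
  by case: (nextP (iter n next (exist _ x0 Px0))).
by case: (nextP (iter N next (exist _ x0 Px0))).
Qed.

(** * t-structures *)

Section TStructure.
Variables (k : fieldType) (D : tricat k) (tau : tpair D).
Hypothesis tauP : is_tstructure tau.
Implicit Types X Y Z W : D.

Local Notation le0 := (tle tau).
Local Notation ge0 := (tge tau).
Local Notation lt0 X := (tle tau (unsh X)).
Local Notation gt0 X := (tge tau (sh X)).

Lemma tle_iso X Y : isomorphic X Y -> le0 X -> le0 Y.
Proof. by case: tauP => _ [+ _] _ _ _; apply. Qed.

Lemma tge_iso X Y : isomorphic X Y -> ge0 X -> ge0 Y.
Proof. by case: tauP => _ [_ +] _ _ _; apply. Qed.

Lemma tle_sh X : le0 X -> le0 (sh X).
Proof.
case: tauP => _ _ [+ _] _ _ => H X0; apply: H.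
by exists X => //; apply: isomorphic_refl.
Qed.

Lemma tge_unsh X : ge0 X -> ge0 (unsh X).
Proof.
case: tauP => _ _ [_ +] _ _ => H X0; apply: H.
by exists X => //; apply: isomorphic_refl.
Qed.

Lemma tlt_le X : lt0 X -> le0 X.
Proof. by move/tle_sh; apply: tle_iso (sh_unshK X). Qed.

Lemma tgt_ge X : gt0 X -> ge0 X.
Proof. by move/tge_unsh; apply: tge_iso (unsh_shK X). Qed.

Lemma tlt_sh X : le0 X -> lt0 (sh X).
Proof. exact/tle_iso/isomorphic_sym/unsh_shK. Qed.

Lemma tgt_unsh X : ge0 X -> gt0 (unsh X).
Proof. exact/tge_iso/isomorphic_sym/sh_unshK. Qed.

Lemma hom_tle_tgt X Y : le0 X -> gt0 Y -> hom_vanishes X Y.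
Proof.
case: tauP => _ _ _ orth _ X0 Y0; apply: orth => //.
by exists (sh Y) => //; apply/isomorphic_sym/unsh_shK.
Qed.

Lemma hom_tlt_tge X Y : lt0 X -> ge0 Y -> hom_vanishes X Y.
Proof.
move=> X0 Y0; apply: hom_vanishes_isor (sh_unshK Y) _.
by apply/hom_vanishes_unsh_sh/hom_tle_tgt => //; apply: tgt_unsh.
Qed.

Lemma truncation_le X : exists Y Z, [/\ le0 Y, gt0 Z & triangle Y X Z].
Proof.
case: tauP => _ _ _ _ /(_ X Logic.I)[Y [Z [Y0 [W W0 ZW] T]]].
exists Y, Z; split=> //; apply: tge_iso W0; apply: isomorphic_sym.
exact: isomorphic_trans (isomorphic_fob sh ZW) (sh_unshK _).
Qed.

Lemma truncation_lt X : exists Y Z, [/\ lt0 Y, ge0 Z & triangle Y X Z].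
Proof.
have [Y [Z [Y0 Z0 /triangle_sh T]]] := truncation_le (unsh X).
exists (sh Y), (sh Z); split=> //; first exact: tlt_sh.
exact: triangle_iso (isomorphic_refl _) (sh_unshK X) (isomorphic_refl _) T.
Qed.

(** Each half of the t-structure is the orthogonal of the other one: if the
    truncation morphism X -> Z vanishes, then Z = 0 by orthogonality. *)
Lemma tleP X : le0 X <-> forall Y, gt0 Y -> hom_vanishes X Y.
Proof.
split=> [X0 Y Y0 | X0]; first exact: hom_tle_tgt.
have [Y [Z [Y0 Z0 T]]] := truncation_le X.
have XY : isomorphic Y X.
  apply: (triangle_zero3 T).
  apply: (hom_vanishes_extl (triangle_rot T)); first exact: X0.
  exact: hom_tle_tgt (tle_sh Y0) Z0.
exact: tle_iso XY Y0.
Qed.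

Lemma tltP X : lt0 X <-> forall Y, ge0 Y -> hom_vanishes X Y.
Proof.
split=> [X0 Y Y0 | X0]; first exact: hom_tlt_tge.
by apply/tleP => Y Y0; apply/hom_vanishes_unsh_sh/X0.
Qed.

Lemma tgtP X : gt0 X <-> forall Y, le0 Y -> hom_vanishes Y X.
Proof.
split=> [X0 Y Y0 | X0]; first exact: hom_tle_tgt.
have [Y [Z [Y0 Z0 T]]] := truncation_le X.
have XZ : isomorphic Z X.
  apply/isomorphic_sym/(triangle_zero1 T).
  apply: (hom_vanishes_extr (triangle_unrot T)); last exact: X0.
  apply/hom_vanishes_sh_unsh; apply: hom_tle_tgt => //; exact: tle_sh.
exact/(tge_iso _ Z0)/isomorphic_fob.
Qed.

Lemma tgeP X : ge0 X <-> forall Y, lt0 Y -> hom_vanishes Y X.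
Proof.
split=> [X0 Y Y0 | X0]; first exact: hom_tlt_tge.
apply: tge_iso (sh_unshK X) _; apply/tgtP => Y Y0.
by apply/hom_vanishes_sh_unsh/X0/tlt_sh.
Qed.

Lemma tle_ext X Y Z : triangle X Y Z -> le0 X -> le0 Z -> le0 Y.
Proof.
move=> T /tleP X0 /tleP Z0; apply/tleP => W W0.
by apply: hom_vanishes_extl T (X0 W W0) (Z0 W W0).
Qed.

Lemma tge_ext X Y Z : triangle X Y Z -> ge0 X -> ge0 Z -> ge0 Y.
Proof.
move=> T /tgeP X0 /tgeP Z0; apply/tgeP => W W0.
by apply: hom_vanishes_extr T (X0 W W0) (Z0 W W0).
Qed.

Lemma tlt_filt S : (forall X, S X -> lt0 X) -> forall X, filt S X -> lt0 X.
Proof.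
move=> SX; apply: filt_ind_ext => // [X X0 | X Y Z X0 Z0 /triangle_unsh T].
  by apply/tltP => Y _; apply: is_zero_source.
exact: tle_ext T X0 Z0.
Qed.

Lemma tge_filt S : (forall X, S X -> ge0 X) -> forall X, filt S X -> ge0 X.
Proof.
move=> SX; apply: filt_ind_ext => // [X X0 | X Y Z X0 Z0 T].
  by apply/tgeP => Y _; apply: is_zero_target.
exact: tge_ext T X0 Z0.
Qed.

(** ** Simple-minded collections in the heart *)

Section SimpleMinded.
Variables (I : finType) (G : I -> D).
Hypotheses (G_heart : forall i, heart tau (G i)) (G_orth : hom_orthonormal G).

Lemma tle_iter_sh i m : le0 (iter m (fob sh) (G i)).
Proof. by elim: m => [|m IH] /=; [case: (G_heart i) | apply: tle_sh]. Qed.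

Lemma tge_iter_unsh i m : ge0 (iter m (fob unsh) (G i)).
Proof. by elim: m => [|m IH] /=; [case: (G_heart i) | apply: tge_unsh]. Qed.

Lemma tlt_pos_shift X : pos_shift G X -> lt0 X.
Proof.
move=> [i [m /isomorphic_sym/(isomorphic_fob unsh) XG]].
exact/(tle_iso XG)/tlt_sh/tle_iter_sh.
Qed.

Lemma tge_nonpos_shift X : nonpos_shift G X -> ge0 X.
Proof.
by move=> [i [m /isomorphic_sym XG]]; apply/(tge_iso XG)/tge_iter_unsh.
Qed.

Lemma hom_generators i j (f : hom (G i) (G j)) : f = 0 \/ is_iso f.
Proof.
have [bij orth] := G_orth; have [ij | /eqP ij] := eqVneq i j; last first.
  by left; apply: orth.
subst j; have [g _ gK] := bij i; rewrite -(gK f).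
have [-> | a0] := eqVneq (g f) 0; first by left; rewrite scale0r.
right; exists ((g f)^-1 *: idm (G i)).
have compZ (a b : k) : (a *: idm (G i)) \c (b *: idm (G i)) = (a * b) *: idm (G i).
  have := comp_linear_r (a *: idm (G i)) b (idm (G i)) 0.
  rewrite compm1 comp0r !addr0 => ->; by rewrite scalerA mulrC.
by rewrite !compZ mulVf // mulfV // scale1r.
Qed.

(** Only a pair of equal adjacent letters G i [1], G i can interact: all other
    boundary morphisms vanish for degree reasons or by orthogonality. *)
Lemma boundary_zero_or_iso X Y : pos_shift G X -> nonpos_shift G Y ->
  forall f : hom X (sh Y), f = 0 \/ is_iso f.
Proof.
move=> [i [m XG]] [j [m' YG]] f.
have vanish : hom_vanishes (iter m.+1 (fob sh) (G i))
                (sh (iter m' (fob unsh) (G j))) -> f = 0 \/ is_iso f.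
  move=> H; left; apply: hom_vanishes_iso H f; first exact: isomorphic_sym.
  exact/isomorphic_fob/isomorphic_sym.
case: m XG vanish => [|m] XG vanish; last first.
  by apply: vanish; apply/hom_vanishes_sh/hom_tlt_tge;
    [apply/tlt_sh/tle_iter_sh | apply: tge_iter_unsh].
case: m' YG vanish => [|m'] YG vanish; last first.
  apply: vanish; apply: hom_vanishes_isor (isomorphic_sym (sh_unshK _)) _.
  by apply: hom_tlt_tge; [apply/tlt_sh/(tle_iter_sh i 0) | apply: tge_iter_unsh].
have [a [a' [a'a aa']]] := XG.
have [b [b' [b'b bb']]] := isomorphic_fob sh YG.
have [g gE] := sh_full (b \c f \c a').
have fE : f = b' \c fmor sh g \c a by rewrite gE -!compA a'a compm1 compA b'b comp1m.
have [g0 | [g' [g'g gg']]] := hom_generators g.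
  by left; rewrite fE g0 fmor0 comp0r comp0l.
right; exists (a' \c fmor sh g' \c b); rewrite fE; split.
  rewrite -!compA (compA b) bb' comp1m (compA (fmor sh g')) -fmor_comp g'g.
  by rewrite fmor_id comp1m.
rewrite -!compA (compA a) aa' comp1m (compA (fmor sh g)) -fmor_comp gg'.
by rewrite fmor_id comp1m.
Qed.

Variable A : D -> Prop.
Hypothesis A_gen : thickly_generated G A.

(** The identity of X factors through W in [sorted_filt], and there through the
    part L of positive shifts, since X has no morphism to the other part. *)
Lemma simple_minded_lt X : A X ->
  (forall i m, hom_vanishes X (iter m (fob unsh) (G i))) -> lt0 X.
Proof.
move=> AX XG; have [W [L [R [FL FR T]]] [i [p pi]]] :=
  thickly_generated_sorted boundary_zero_or_iso A_gen AX.
have XR : hom_vanishes X R.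
  move: R FR {T}; apply: filt_ind_ext.
  - by move=> R; apply: is_zero_target.
  - by move=> R [j [m /isomorphic_sym RG]]; apply: hom_vanishes_isor RG (XG j m).
  - by move=> ? ? ? h1 h2 T; apply: hom_vanishes_extr T h1 h2.
have /tltP L0 := tlt_filt tlt_pos_shift FL.
have [f [g [h T']]] := T; have [s fs] := dist_lift T' (XR (g \c i)).
apply/tltP => Y Y0 q.
by rewrite -(compm1 q) -pi -fs !compA (L0 Y Y0 (q \c p \c f)) comp0l.
Qed.

Lemma simple_minded_ge X : A X ->
  (forall i m, hom_vanishes (iter m.+1 (fob sh) (G i)) X) -> ge0 X.
Proof.
move=> AX XG; have [W [L [R [FL FR T]]] [i [p pi]]] :=
  thickly_generated_sorted boundary_zero_or_iso A_gen AX.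
have LX : hom_vanishes L X.
  move: L FL {T}; apply: filt_ind_ext.
  - by move=> L; apply: is_zero_source.
  - by move=> L [j [m /isomorphic_sym LG]]; apply: hom_vanishes_isol LG (XG j m).
  - by move=> ? ? ? h1 h2 T; apply: hom_vanishes_extl T h1 h2.
have /tgeP R0 := tge_filt tge_nonpos_shift FR.
have [f [g [h T']]] := T; have [s sg] := dist_extend T' (LX (p \c f)).
apply/tgeP => Y Y0 q.
by rewrite -(comp1m q) -pi -sg -!compA (R0 Y Y0 (g \c (i \c q))) comp0r.
Qed.

End SimpleMinded.

(** ** Torsion pairs in the heart *)

Section Torsion.
Variables (I : Type) (G : I -> D).
Hypothesis G_heart : forall i, heart tau (G i).

(** Not restricted to the heart: since the G i lie in the heart, the condition
    on X only depends on its top cohomology. *)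
Definition torsion X : Prop := le0 X /\ forall i, hom_vanishes X (G i).

Definition torsionfree X : Prop := ge0 X /\ forall i, hom_vanishes (G i) X.

Lemma torsion_ext X Y Z : triangle X Y Z -> torsion X -> torsion Z -> torsion Y.
Proof.
move=> T [X0 XG] [Z0 ZG]; split; first exact: tle_ext T X0 Z0.
by move=> i; apply: hom_vanishes_extl T (XG i) (ZG i).
Qed.

Lemma torsionfree_ext X Y Z :
  triangle X Y Z -> torsionfree X -> torsionfree Z -> torsionfree Y.
Proof.
move=> T [X0 XG] [Z0 ZG]; split; first exact: tge_ext T X0 Z0.
by move=> i; apply: hom_vanishes_extr T (XG i) (ZG i).
Qed.

Lemma tlt_torsion X : lt0 X -> torsion X.
Proof.
move=> X0; split=> [|i]; first exact: tlt_le.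
by apply: hom_tlt_tge => //; case: (G_heart i).
Qed.

Lemma tgt_torsionfree X : gt0 X -> torsionfree X.
Proof.
move=> X0; split=> [|i]; first exact: tgt_ge.
by apply: hom_tle_tgt => //; case: (G_heart i).
Qed.

Lemma dist_mono_in U E F (u : hom U E) (e : hom E F) (w : hom F (sh U)) :
  ge0 F -> dist u e w -> mono_in (heart tau) u.
Proof.
move=> F0 T Z [Z0 _] g h gh; apply/eqP; rewrite -subr_eq0; apply/eqP.
apply: (dist_mono T); last by rewrite compBr gh subrr.
exact: hom_tlt_tge (tlt_sh Z0) F0.
Qed.

(** Take U maximal among the torsion subobjects of E with quotient in the heart.
    For x : c -> F from a torsion object, let q y : F -> Q be the cokernel of x
    in the heart, with y : F -> X the cone of x and q : X -> Q the truncation of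
    X in D^{>=0}. The kernel V of E -> Q is an extension of U by the image of x,
    hence torsion, so V = U. Thus E -> F vanishes on V and factors through
    E -> Q, whence F is a retract of Q along q y, which kills x. *)
Lemma torsion_pair_noetherian E : noetherian tau -> heart tau E ->
  exists U F, [/\ torsion U, ge0 F, triangle U E F &
                  forall c, torsion c -> hom_vanishes c F].
Proof.
move=> noeth hE.
pose P (U : subobject (heart tau) E) := torsion (sub_ob U) /\
  exists (F : D) (e : hom E F) w, heart tau F /\ dist (sub_mor U) e w.
have [O O0] := exists_zero D.
have [||U [[torU [F [e [w [hF T]]]]] Umax]] :=
    exists_maximal (R := @sub_le _ _ _ E) (P := P).
- by move=> U /(noeth E hE U)[N /(_ N.+1 (leqnSn N))[? _]]; exists N.
- have [f [g [h T]]] := triangle_idl E O0.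
  have hO : heart tau O.
    split; first by apply/tleP => Y _; apply: is_zero_source.
    by apply/tgeP => Y _; apply: is_zero_target.
  exists (Subobject hO (dist_mono_in (proj2 hE) T)); split=> /=.
    by split=> [|i]; [case: hO | apply: is_zero_source].
  by exists E, g, h.
have [F_le F_ge] := hF.
exists (sub_ob U), F; split=> //; first by exists (sub_mor U), e, w.
move=> c torc x.
have [X [y [z Tx]]] := dist_cone x.
have [L [Q [L0 Q0 [l [q [w' TQ]]]]]] := truncation_lt X.
(* J is the image of x in the heart, an extension of L by c. *)
have [J [j [w1 [TJ TcL]]]] := fiber_comp Tx TQ.
have [V [v [w2 [TV TUJ]]]] := fiber_comp T TJ.
have torV : torsion V.
  by apply: torsion_ext TUJ torU (torsion_ext TcL torc (tlt_torsion L0)).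
have X_le : le0 X.
  apply: tle_ext _ F_le (tle_sh (proj1 torc)).
  by apply: triangle_rot; exists x, y, z.
have Q_le : le0 Q.
  apply: tle_ext _ X_le (tle_sh (tlt_le L0)).
  by apply: triangle_rot; exists l, q, w'.
have hV : heart tau V.
  split; first by case: torV.
  have T' : triangle V E Q by exists v, (q \c y \c e), w2.
  exact: tge_ext (triangle_unrot T') (tge_unsh Q0) (proj2 hE).
have vm := dist_mono_in Q0 TV.
have [||h' /= uh'] := Umax (Subobject hV vm).
- by split=> //; exists Q, (q \c y \c e), w2.
- have [|h' vh'] := dist_lift (p := sub_mor U) TV.
    by rewrite -compA (dist_comp0 T) comp0r.
  by exists h'.
have [|s se] := dist_extend (p := e) TV.
  by rewrite -uh' compA (dist_comp0 T) comp0l.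
have sqy : s \c (q \c y) = idm F.
  apply/eqP; rewrite -subr_eq0; apply/eqP; apply: (dist_epi T).
    by apply: hom_tlt_tge F_ge; apply: tlt_sh; case: torU.
  by rewrite compBl comp1m -compA se subrr.
by rewrite -(comp1m x) -sqy -!compA (dist_comp0 Tx) !comp0r.
Qed.

(** The mirror image: K is minimal among the subobjects of E with torsion-free
    quotient, and for x : K -> c the kernel L of x, whose quotient in E is an
    extension of E/K by the image of x, has to be K. *)
Lemma torsion_pair_artinian E : artinian tau -> heart tau E ->
  exists K F, [/\ le0 K, torsionfree F, triangle K E F &
                  forall c, torsionfree c -> hom_vanishes K c].
Proof.
move=> art hE.
pose P (U : subobject (heart tau) E) :=
  exists (F : D) (e : hom E F) w, torsionfree F /\ dist (sub_mor U) e w.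
have [O O0] := exists_zero D.
have [||U [[F [e [w [torF T]]]] Umin]] :=
    exists_maximal (R := fun U V => @sub_le _ _ _ E V U) (P := P).
- by move=> U /(art E hE U)[N /(_ N.+1 (leqnSn N))[_ ?]]; exists N.
- have T0 := dist_id E O0.
  have O_ge : ge0 O by apply/tgeP => Y _; apply: is_zero_target.
  exists (Subobject hE (dist_mono_in O_ge T0)).
  by exists O, 0, 0; do 2! split=> //; move=> i; apply: is_zero_target.
have [K_le K_ge] := sub_mem U.
exists (sub_ob U), F; split=> //; first by exists (sub_mor U), e, w.
move=> c torc x.
have [X [y [z /dist_unrot]]] := dist_cone x.
move=> [y' [z' Tx]].
have [L [Q [L0 Q0 [l [q [w' TL]]]]]] := truncation_le (unsh X).
have [J [j [w1 [TJ TQc]]]] := cone_comp TL Tx.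
have [V [v [w2 [TV TJF]]]] := cone_comp TJ T.
have torV : torsionfree V.
  exact: torsionfree_ext TJF (torsionfree_ext TQc (tgt_torsionfree Q0) torc) torF.
have X_ge : ge0 (unsh X).
  apply: tge_ext _ (tge_unsh (proj1 torc)) K_ge.
  by apply: triangle_unrot; exists y', x, z'.
have hL : heart tau L.
  split=> //; apply: tge_ext _ (tge_unsh (tgt_ge Q0)) X_ge.
  by apply: triangle_unrot; exists l, q, w'.
have lm := dist_mono_in (proj1 torV) TV.
have [||s /= us] := Umin (Subobject hL lm).
- by exists V, v, w2.
- by exists (y' \c l); rewrite /= compA.
have jls : y' \c l \c s = idm (sub_ob U).
  apply/eqP; rewrite -subr_eq0; apply/eqP; apply: (dist_mono T).
    by apply: hom_tlt_tge (tlt_sh K_le) _; case: torF.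
  by rewrite compBr compm1 compA -[RHS](subrr (sub_mor U)) -{3}us compA.
by rewrite -(compm1 x) -jls !compA (dist_comp0 Tx) !comp0l.
Qed.

(** Removes first the cohomology of X in positive degrees, then the part of its
    top cohomology that receives no morphism from torsion objects. *)
Lemma torsion_coreflection X : noetherian tau ->
  exists Y Z, [/\ torsion Y, triangle Y X Z &
                  forall c, torsion c -> hom_vanishes c Z].
Proof.
move=> noeth.
have [X0 [X1 [X0_le X1_gt T1]]] := truncation_le X.
have [X0' [E [X0'_lt E_ge T2]]] := truncation_lt X0.
have hE : heart tau E.
  split=> //; exact: tle_ext (triangle_rot T2) X0_le (tle_sh (tlt_le X0'_lt)).
have [U [F [torU F_ge T3 orthF]]] := torsion_pair_noetherian noeth hE.
have [Y T4 T5] := triangle_assocr T2 T3.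
have [Z T6 T7] := triangle_assocl T5 T1.
exists Y, Z; split=> // [|c torc].
  exact: torsion_ext T4 (tlt_torsion X0'_lt) torU.
apply: hom_vanishes_extr T7 (orthF c torc) _.
by apply: hom_tle_tgt => //; case: torc.
Qed.

Lemma torsionfree_reflection X : artinian tau ->
  exists Y Z, [/\ torsionfree Z, triangle Y X Z &
                  forall c, torsionfree c -> hom_vanishes Y c].
Proof.
move=> art.
have [X1 [X0 [X1_lt X0_ge T1]]] := truncation_lt X.
have [E [X0' [E_le X0'_gt T2]]] := truncation_le X0.
have hE : heart tau E.
  split=> //; exact: tge_ext (triangle_unrot T2) (tge_unsh (tgt_ge X0'_gt)) X0_ge.
have [K [F [K_le torF T3 orthK]]] := torsion_pair_artinian art hE.
have [Z T4 T5] := triangle_assocl T3 T2.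
have [Y T6 T7] := triangle_assocr T1 T4.
exists Y, Z; split=> // [|c torc].
  exact: torsionfree_ext T5 torF (tgt_torsionfree X0'_gt).
apply: hom_vanishes_extl T6 _ (orthK c torc).
by apply: hom_tlt_tge => //; case: torc.
Qed.

End Torsion.
End TStructure.

(** * Induced t-structures *)

Section Induced.
Variables (k : fieldType) (D : tricat k) (tau : tpair D).
Hypothesis tauP : is_tstructure tau.
Implicit Types (X Y Z : D) (A B C : D -> Prop).

Lemma triangulated_shiftE A : triangulated_sub A ->
  forall X n, A (shift X n) -> A X.
Proof.
move=> [Aiso _ Ash Aunsh _] X.
have shE Y : A (sh Y) -> A Y by move/Aunsh; apply: Aiso (unsh_shK Y).
have unshE Y : A (unsh Y) -> A Y by move/Ash; apply: Aiso (sh_unshK Y).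
by case=> m /=; [elim: m => [|m IH] //= /shE | elim: m => [|m IH] //= /unshE].
Qed.

Lemma triangulated_ext A X Y Z :
  triangulated_sub A -> triangle X Y Z -> A X -> A Z -> A Y.
Proof.
move=> [_ _ _ Aunsh Acone] /triangle_unrot T AX AZ.
by apply: Acone T _ AX; apply: Aunsh.
Qed.

Lemma bounded_conn A :
  triangulated_sub A -> bounded tau -> bounded_on A (conn_pair tau A).
Proof.
move=> Atri bd X AX; have [a [b [[Y Y0 XY] [Z Z0 XZ]]]] := bd X Logic.I.
have Aiso := let: And5 h _ _ _ _ := Atri in h.
have AY := triangulated_shiftE Atri (Aiso _ _ XY AX).
have AZ := triangulated_shiftE Atri (Aiso _ _ XZ AX).
exists a, b; split; last by exists Z.
exists Y => //; split=> // W [W0 _].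
exact: (hom_tlt_tge tauP) (tlt_sh tauP W0) Y0.
Qed.

Lemma bounded_coconn A :
  triangulated_sub A -> bounded tau -> bounded_on A (coconn_pair tau A).
Proof.
move=> Atri bd X AX; have [a [b [[Y Y0 XY] [Z Z0 XZ]]]] := bd X Logic.I.
have Aiso := let: And5 h _ _ _ _ := Atri in h.
have AY := triangulated_shiftE Atri (Aiso _ _ XY AX).
have AZ := triangulated_shiftE Atri (Aiso _ _ XZ AX).
exists a, b; split; first by exists Y.
exists Z => //; split=> // W [W0 _].
exact: (hom_tle_tgt tauP) Z0 (tgt_unsh tauP W0).
Qed.

(** As the coaisle of [conn_pair] is an orthogonal, every axiom except the
    existence of truncation triangles is formal. *)
Lemma connectively_inducesP A : triangulated_sub A ->
  (forall X, A X -> exists Y Z, [/\ tle tau Y /\ A Y, triangle Y X Z &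
     forall W, tle tau W -> A W -> hom_vanishes W Z]) ->
  connectively_induces tau A.
Proof.
move=> Atri trunc; have [Aiso _ Ash Aunsh Acone] := Atri.
split.
- by split=> X [].
- split=> X Y XY [].
    by move=> X0 AX; split; [apply: (tle_iso tauP) XY X0 | apply: Aiso XY AX].
  move=> AX orth; split=> [|W lW]; first exact: Aiso XY AX.
  exact: hom_vanishes_isor XY (orth W lW).
- split=> X [Y [Y1 Y2] /isomorphic_sym YX].
    split; last exact/(Aiso _ _ YX)/Ash.
    exact/(tle_iso tauP YX)/(tle_sh tauP).
  split=> [|W [W0 AW]]; first exact/(Aiso _ _ YX)/Aunsh.
  apply: hom_vanishes_isor YX _; apply: (iffLR (hom_vanishes_sh_unsh (sh W) Y)).
  apply: (Y2 (sh W)).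
  by split; [apply: tle_sh | apply: Ash].
- move=> X Y lX [Z [_ orth] YZ]; apply: hom_vanishes_isor (isomorphic_sym YZ) _.
  exact: (iffLR (hom_vanishes_sh_unsh X Z)) (orth X lX).
move=> X AX; have [Y [Z [[Y0 AY] T orth]]] := trunc X AX.
exists Y, Z; split=> //; exists (sh Z); last exact/isomorphic_sym/unsh_shK.
split=> [|W [W0 AW]]; first exact/Ash/(Acone _ _ _ T).
exact/hom_vanishes_sh/orth.
Qed.

Lemma coconnectively_inducesP A : triangulated_sub A ->
  (forall X, A X -> exists Y Z, [/\ tge tau Z /\ A Z, triangle Y X Z &
     forall W, tge tau W -> A W -> hom_vanishes Y W]) ->
  coconnectively_induces tau A.
Proof.
move=> Atri trunc; have [Aiso _ Ash Aunsh Acone] := Atri.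
split.
- by split=> X [].
- split=> X Y XY [].
    move=> AX orth; split=> [|W gW]; first exact: Aiso XY AX.
    exact: hom_vanishes_isol XY (orth W gW).
  by move=> X0 AX; split; [apply: (tge_iso tauP) XY X0 | apply: Aiso XY AX].
- split=> X [Y [Y1 Y2] /isomorphic_sym YX]; last first.
    split; last exact/(Aiso _ _ YX)/Aunsh.
    exact/(tge_iso tauP YX)/(tge_unsh tauP).
  split=> [|W [W0 AW]]; first exact/(Aiso _ _ YX)/Ash.
  apply: hom_vanishes_isol YX _; apply: (iffRL (hom_vanishes_sh_unsh Y (unsh W))).
  apply: (Y2 (unsh W)).
  by split; [apply: tge_unsh | apply: Aunsh].
- move=> X Y [AX orth] [Z gZ YZ].
  exact: hom_vanishes_isor (isomorphic_sym YZ) (orth Z gZ).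
(* The given triangles cut between degrees -1 and 0, so X is shifted first. *)
move=> X AX; have [Y [Z [[Z0 AZ] T orth]]] := trunc (sh X) (Ash _ AX).
have AY : A Y := triangulated_ext Atri (triangle_unrot T) (Aunsh _ AZ) (Ash _ AX).
exists (unsh Y), (unsh Z); split; last 1 first.
- exact: triangle_iso (isomorphic_refl _) (unsh_shK X) (isomorphic_refl _)
    (triangle_unsh T).
- split=> [|W [W0 AW]]; first exact: Aunsh.
  apply/hom_vanishes_unsh_sh; apply: hom_vanishes_isor (orth W W0 AW).
  exact/isomorphic_sym/sh_unshK.
- by exists Z => //; apply: isomorphic_refl.
Qed.

Section Semiorthogonal.
Variables (B C : D -> Prop) (BC : semiorthogonal_decomposition B C).
Variables (n : nat) (G : 'I_n -> D).
Hypotheses (G_heart : forall i, heart tau (G i)) (G_orth : hom_orthonormal G).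

Lemma hom_semiorthogonal X Y : C X -> B Y -> hom_vanishes X Y.
Proof. by case: BC => _ _ orth _; apply: (orth X Y 0). Qed.

Lemma noetherian_connectively_induces :
  noetherian tau -> thickly_generated G B -> connectively_induces tau C.
Proof.
move=> noeth Bgen; have [Btri Ctri _ dec] := BC.
have BG i : B (G i) by case: Bgen.
have torC W : tle tau W -> C W -> torsion tau G W.
  by move=> W0 CW; split=> // i; apply: hom_semiorthogonal CW (BG i).
apply: connectively_inducesP => // X CX.
have [X' [F [[X'0 X'G] T1 orthF]]] := torsion_coreflection tauP G_heart X noeth.
have [Y [b [CY Bb T2]]] := dec X'.
have [Z T3 T4] := triangle_assocl T2 T1.
exists Y, Z; split=> // [|W W0 CW]; last first.
  exact: hom_vanishes_extr T4 (hom_semiorthogonal CW Bb) (orthF _ (torC W W0 CW)).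
split=> //; apply: (tle_ext tauP (triangle_unrot T2) _ X'0).
apply: (simple_minded_lt tauP G_heart G_orth Bgen Bb) => i m.
have [_ _ _ Bunsh _] := Btri; have [_ _ Csh _ _] := Ctri.
apply: hom_vanishes_extl (triangle_rot T2) _ _.
  case: m => [|m]; first exact: X'G.
  by apply: (hom_tle_tgt tauP X'0); apply: (tgt_unsh tauP); apply: tge_iter_unsh.
apply: hom_semiorthogonal; first exact: Csh.
by elim: m => [|m IH]; [apply: BG | apply: Bunsh].
Qed.

Lemma artinian_coconnectively_induces :
  artinian tau -> thickly_generated G C -> coconnectively_induces tau B.
Proof.
move=> art Cgen; have [Btri Ctri _ dec] := BC.
have CG i : C (G i) by case: Cgen.
have torB W : tge tau W -> B W -> torsionfree tau G W.
  by move=> W0 BW; split=> // i; apply: hom_semiorthogonal (CG i) BW.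
apply: coconnectively_inducesP => // X BX.
have [F [X' [[X'0 X'G] T1 orthF]]] := torsionfree_reflection tauP G_heart X art.
have [c [Z [Cc BZ T2]]] := dec X'.
have [Y T3 T4] := triangle_assocr T1 T2.
exists Y, Z; split=> // [|W W0 BW]; last first.
  exact: hom_vanishes_extl T3 (orthF _ (torB W W0 BW)) (hom_semiorthogonal Cc BW).
split=> //; apply: (tge_ext tauP (triangle_rot T2) X'0 _).
have [_ _ Csh _ _] := Ctri; have [_ _ _ Bunsh _] := Btri.
apply: (simple_minded_ge tauP G_heart G_orth Cgen (Csh _ Cc)) => i m.
apply/hom_vanishes_sh; apply: hom_vanishes_extr (triangle_unrot T2) _ _.
  apply: hom_semiorthogonal; last exact: Bunsh.
  by elim: m => [|m IH]; [apply: CG | apply: Csh].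
case: m => [|m]; first exact: X'G.
by apply: (hom_tlt_tge tauP _ X'0); apply: (tlt_sh tauP); apply: tle_iter_sh.
Qed.

End Semiorthogonal.
End Induced.

Theorem theorem5p12 (k : fieldType) (D : tricat k) (tau : tpair D)
    (B C : D -> Prop)
    (tauP : is_tstructure tau)
    (BC : semiorthogonal_decomposition B C) :
  (noetherian tau ->
   forall (n : nat) (G : 'I_n -> D),
     thickly_generated G B ->
     (forall i, heart tau (G i)) ->
     hom_orthonormal G ->
     connectively_induces tau C /\
     (bounded tau -> bounded_on C (conn_pair tau C)))
  /\
  (artinian tau ->
   forall (n : nat) (G : 'I_n -> D),
     thickly_generated G C ->
     (forall i, heart tau (G i)) ->
     hom_orthonormal G ->
     coconnectively_induces tau B /\
     (bounded tau -> bounded_on B (coconn_pair tau B))).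
Proof.
have [Btri Ctri _ _] := BC.
split=> [noeth | art] n G gen G_heart G_orth.
  split; last exact: bounded_conn.
  exact: (noetherian_connectively_induces tauP BC G_heart G_orth noeth gen).
split; last exact: bounded_coconn.
exact: (artinian_coconnectively_induces tauP BC G_heart G_orth art gen).
Qed.
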